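(* Let $R$ be a commutative ring and $\mathcal{I}$ a set of faithful finitely generated ideals of $R$, with a fixed finite generating set chosen for each $I\in\mathcal{I}$. Then the Fuchs–Salce tilting module $\delta_{\mathcal{I}}$ is a 1-tilting module generating the 1-tilting class $\mathcal{I}\text{-Div}=\{M\in\mathrm{Mod}\text{-}R\mid M=IM\text{ for all } I\in\mathcal{I}\}$; that is, $\delta_{\mathcal{I}}^\perp=\mathrm{Gen}(\delta_{\mathcal{I}})=\mathcal{I}\text{-Div}$.
   Context: An ideal $I$ is faithful if $\mathrm{Ann}(I)=0$. A module $T$ is 1-tilting if $\mathrm{pd}\,T\le1$, $\mathrm{Ext}^1_R(T,T^{(X)})=0$ for every set $X$, and there is an exact sequence $0\to R\to T_0\to T_1\to0$ with $T_0,T_1$ direct summands of direct sums of copies of $T$; the class $T^\perp=\{M\mid\mathrm{Ext}^1_R(T,M)=0\}$ is then called a 1-tilting class (and $T^\perp=\mathrm{Gen}(T)$, the class of all homomorphic images of direct sums of copies of $T$). Construction of $\delta_{\mathcal{I}}$: for each $I\in\mathcal{I}$ fix a finite generating set $\{x^I_1,\dots,x^I_{n_I}\}$ of $I$. Let $\Lambda$ be the set of all finite sequences of pairs $(I,k)$ with $I\in\mathcal{I}$ and $k\in\{1,\dots,n_I\}$, including the empty sequence $w$. Let $F$ be the free $R$-module with basis $\Lambda$. For $\lambda\in\Lambda$ let $\lambda\sqcup(I,k)$ denote the sequence obtained by appending $(I,k)$ to $\lambda$. Let $G$ be the submodule of $F$ spanned by all elements $\lambda-\sum_{k=1}^{n_I}x^I_k(\lambda\sqcup(I,k))$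 for $\lambda\in\Lambda$ and $I\in\mathcal{I}$. Put $M_{\mathcal{I}}=F/G$, and let $\mathrm{Span}(w)$ be the submodule of $M_{\mathcal{I}}$ generated by the image of $w$. Then $\delta_{\mathcal{I}}=M_{\mathcal{I}}\oplus M_{\mathcal{I}}/\mathrm{Span}(w)$. *)

(* Defs.v *)
From HB Require Import structures.
From mathcomp Require Import all_boot all_algebra.
From mathcomp Require Import boolp classical_sets functions cardinality.

Set Implicit Arguments.
Unset Strict Implicit.
Unset Printing Implicit Defensive.

Import GRing.Theory.

Local Open Scope classical_set_scope.
Local Open Scope quotient_scope.
Local Open Scope ring_scope.

(* Rings may be trivial (pzRing), and Mod-R is [lmodType R]: R is commutative
   wherever this matters, so left and right modules agree. *)

Section Span.
Variables (R : pzRingType) (V : lmodType R).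

Definition span (S : set V) : set V :=
  [set v | exists (n : nat) (c : 'I_n -> R) (u : 'I_n -> V),
     (forall i, S (u i)) /\ v = \sum_(i < n) c i *: u i].

(* [span S] as a boolean predicate, the form [Quotient.quot] expects. *)
Definition spanb (S : set V) : {pred V} := fun v => `[< span S v >].

Lemma spanb_closed S : submod_closed (spanb S).
Proof.
split.
  apply/asboolP; exists 0%N, (fun=> 0), (fun=> 0); split; first by case.
  by rewrite big_ord0.
move=> a u v /asboolP [m [c [s [Hs ->]]]] /asboolP [n [d [t [Ht ->]]]].
apply/asboolP; exists (m + n)%N.
exists (fun i => match fintype.split i with inl j => a * c j | inr j => d j end).
exists (fun i => match fintype.split i with inl j => s j | inr j => t j end).
split; first by move=> i; case: (fintype.split i).
rewrite big_split_ord /= scaler_sumr; congr (_ + _); apply: eq_bigr => i _.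
  have -> : fintype.split (lshift n i) = inl i by apply: (unsplitK (inl i)).
  by rewrite scalerA.
by have -> : fintype.split (rshift m i) = inr i by apply: (unsplitK (inr i)).
Qed.

HB.instance Definition _ S :=
  GRing.isSubmodClosed.Build R V (spanb S)
    (GRing.submod_closed_semi (spanb_closed S)).

End Span.

Section QuotSpan.
Variables (R : pzRingType) (V : lmodType R) (S : set V).

Definition quot_span : Type := Quotient.quot (spanb S).

HB.instance Definition _ := GRing.Zmodule.on quot_span.

Definition quot_pi (v : V) : quot_span := \pi_(Quotient.quot (spanb S)) v.

Lemma quot_pi_surj (q : quot_span) : exists v, quot_pi v = q.
Proof. by exists (repr q); rewrite /quot_pi reprK. Qed.

Lemma quot_piP u v : (quot_pi u = quot_pi v) <-> span S (u - v).
Proof.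
split=> [/eqP|] H.
  by move: H; rewrite /quot_pi -Quotient.idealrBE => /asboolP.
by apply/eqP; rewrite /quot_pi -Quotient.idealrBE; apply/asboolP.
Qed.

Lemma quot_piD u v : quot_pi (u + v) = quot_pi u + quot_pi v.
Proof. by rewrite /quot_pi Quotient.pi_add. Qed.

Definition quot_scale (a : R) (q : quot_span) : quot_span :=
  quot_pi (a *: repr q).

Lemma quot_piZ a v : quot_pi (a *: v) = quot_scale a (quot_pi v).
Proof.
apply/quot_piP; rewrite -scalerBr; apply/asboolP.
suff H : v - repr (quot_pi v) \in spanb S by exact: (rpredZ a H).
by apply/asboolP/quot_piP; rewrite [RHS]reprK.
Qed.

Fact quot_scaleA a b q : quot_scale a (quot_scale b q) = quot_scale (a * b) q.
Proof. by have [v <-] := quot_pi_surj q; rewrite -!quot_piZ scalerA. Qed.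

Fact quot_scale1 : left_id 1 quot_scale.
Proof. by move=> q; have [v <-] := quot_pi_surj q; rewrite -quot_piZ scale1r. Qed.

Fact quot_scaleDr : right_distributive quot_scale +%R.
Proof.
move=> a p q; have [u <-] := quot_pi_surj p; have [v <-] := quot_pi_surj q.
by rewrite -quot_piD -!quot_piZ scalerDr quot_piD.
Qed.

Fact quot_scaleDl q : {morph quot_scale^~ q : a b / a + b}.
Proof.
by move=> a b; have [v <-] := quot_pi_surj q; rewrite -!quot_piZ scalerDl quot_piD.
Qed.

HB.instance Definition _ := GRing.Zmodule_isLmodule.Build R quot_span
  quot_scaleA quot_scale1 quot_scaleDr quot_scaleDl.

End QuotSpan.

Section DirectSum.
Variables (R : pzRingType) (T : lmodType R) (X : Type).

Definition finsupp : {pred X -> T} :=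
  fun f => `[< finite_set [set x | f x <> 0] >].

Lemma finsupp_closed : submod_closed finsupp.
Proof.
split; first by apply/asboolP; rewrite (_ : [set _ | _] = set0) // -subset0 => x /(_ erefl).
move=> a f g /asboolP Hf /asboolP Hg; apply/asboolP.
apply: (@sub_finite_set _ _ ([set x | f x <> 0] `|` [set x | g x <> 0])).
  move=> x /= Hx; apply: contrapT => /not_orP [/contrapT Hfx /contrapT Hgx].
  by apply: Hx; rewrite -[LHS]/(a *: f x + g x) Hfx Hgx scaler0 addr0.
by rewrite finite_setU.
Qed.

HB.instance Definition _ :=
  GRing.isSubmodClosed.Build R (X -> T) finsupp
    (GRing.submod_closed_semi finsupp_closed).

(* The direct sum T^(X) of X copies of T. *)
Record dsum : Type := DSum { dsum_fun :> X -> T; _ : finsupp dsum_fun }.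

HB.instance Definition _ := [isSub for dsum_fun].
HB.instance Definition _ := [Choice of dsum by <:].
HB.instance Definition _ := [SubChoice_isSubLmodule of dsum by <:].

Lemma finsupp_single (x : X) (t : T) :
  finsupp (fun y => if `[< y = x >] then t else 0).
Proof.
apply/asboolP; apply: (@sub_finite_set _ _ [set x]); last exact: finite_set1.
by move=> y /=; case: asboolP.
Qed.

Definition dsum_in (x : X) (t : T) : dsum := DSum (finsupp_single x t).

End DirectSum.

Section Modules.
Variable R : pzRingType.
Implicit Types A B C M N P T : lmodType R.

Definition short_exact A B C (f : {linear A -> B}) (g : {linear B -> C}) : Prop :=
  [/\ injective f, range f = g @^-1` [set 0] & range g = setT].

Definition isomorphic A B : Prop := exists f : {linear A -> B}, bijective f.

Definition projective P : Prop :=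
  forall A B (g : {linear A -> B}) (f : {linear P -> B}),
    range g = setT -> exists h : {linear P -> A}, forall p, g (h p) = f p.

Definition pd_le1 T : Prop :=
  exists (P1 P0 : lmodType R) (i : {linear P1 -> P0}) (p : {linear P0 -> T}),
    [/\ projective P1, projective P0 & short_exact i p].

Record extension T M := Extension {
  ext_mid : lmodType R;
  ext_inj : {linear M -> ext_mid};
  ext_proj : {linear ext_mid -> T};
  ext_exact : short_exact ext_inj ext_proj
}.

(* By the five lemma the morphism is then an isomorphism, so this is an
   equivalence relation. *)
Definition ext_equiv T M (E E' : extension T M) : Prop :=
  exists h : {linear ext_mid E -> ext_mid E'},
    (forall m, h (ext_inj E m) = ext_inj E' m) /\
    (forall e, ext_proj E' (h e) = ext_proj E e).

Definition split_inj T M (m : M) : (M * T)%type := (m, 0).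

Fact split_inj_linear T M : linear (@split_inj T M).
Proof. by move=> a u v; congr (_, _); rewrite /= scaler0 addr0. Qed.

HB.instance Definition _ T M :=
  GRing.isLinear.Build R M (M * T)%type *:%R (@split_inj T M)
    (@split_inj_linear T M).

Fact split_exact T M :
  @short_exact M (M * T)%type T (@split_inj T M) (@snd M T).
Proof.
split=> [u v [//]||]; last by apply/seteqP; split=> // t _; exists (0, t).
apply/seteqP; split=> [_ [m _ <-] //|[m t] /= ->].
by exists m.
Qed.

Definition split_extension T M : extension T M := Extension (split_exact T M).

(* Yoneda's Ext^1_R(T, M) consists of the extensions 0 -> M -> E -> T -> 0 up to
   equivalence, and its zero is the class of the split extension. *)
Definition Ext1_vanishes T M : Prop :=
  forall E : extension T M, ext_equiv E (split_extension T M).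

(* Classes of modules are predicates on [lmodType R] rather than [set]s: the
   universe of [set] is strictly below that of [lmodType]. *)
Definition perp T : lmodType R -> Prop := fun M => Ext1_vanishes T M.

Definition Gen T : lmodType R -> Prop := fun M =>
  exists (X : Type) (f : {linear dsum T X -> M}), range f = setT.

(* A is a direct summand of a direct sum of copies of T. *)
Definition Add T : lmodType R -> Prop := fun A =>
  exists (X : Type) (C : lmodType R), isomorphic (A * C)%type (dsum T X).

Definition tilting1 T : Prop :=
  [/\ pd_le1 T,
      forall X : Type, Ext1_vanishes T (dsum T X)
    & exists (T0 T1 : lmodType R)
             (i : {linear R^o -> T0}) (p : {linear T0 -> T1}),
        [/\ short_exact i p, Add T T0 & Add T T1]].

End Modules.

Section Ideals.
Variable R : comPzRingType.
Implicit Types (I : set R) (M : lmodType R).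

Definition is_ideal I : Prop :=
  [/\ I 0, forall a b, I a -> I b -> I (a + b) & forall r a, I a -> I (r * a)].

Definition Ann I : set R := [set r | forall a, I a -> r * a = 0].

Definition faithful I : Prop := Ann I = [set 0].

Definition generates n (x : 'I_n -> R) I : Prop := span (V := R^o) (range x) = I.

Definition ideal_smul I M : set M := span [set a *: m | a in I & m in [set: M]].
Arguments ideal_smul I M : clear implicits.

Definition Div (II : set (set R)) : lmodType R -> Prop := fun M =>
  forall I, II I -> [set: M] = ideal_smul I M.

End Ideals.

Section FuchsSalce.
Variables (R : comPzRingType) (II : set (set R)).
Variables (n : II -> nat) (x : forall I : II, 'I_(n I) -> R).

(* Finite sequences of pairs (I, k); the empty sequence w is [::]. *)
Definition FS_index : Type := seq {I : II & 'I_(n I)}.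

Definition FS_free : lmodType R := dsum R^o FS_index.

Definition FS_basis (l : FS_index) : FS_free := dsum_in l (1 : R^o).

Definition FS_relators : set FS_free :=
  [set v | exists (l : FS_index) (I : II),
     v = FS_basis l - \sum_(k < n I)
           x k *: FS_basis (rcons l (existT (fun J : II => 'I_(n J)) I k))].

Definition FS_module : lmodType R := quot_span FS_relators.

Definition FS_w : FS_module := quot_pi FS_relators (FS_basis [::]).

Definition FS_delta : lmodType R := (FS_module * quot_span [set FS_w])%type.

End FuchsSalce.

(* Main.v *)
(* Write F for the free module on finite sequences and M = F/G. Faithfulness makes
   the relators a basis of G, and together with w a basis of G + Rw; hence
   M and M/Rw have projective dimension at most 1 and 0 -> R -> M -> M/Rw -> 0 is
   exact. If N is divisible, a system of lifts of the basis elements can be chosen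
   recursively along the tree of finite sequences, with an arbitrary lift of w;
   hence Ext^1(M, N) = Ext^1(M/Rw, N) = 0 and every element of N is the image of w
   under some map M -> N. Conversely, Ext^1(M/Rw, N) = 0 lets every map R -> N
   extend to M, so that N is generated by the divisible module M. *)

From HB Require Import structures.
Require Import Defs.
From mathcomp Require Import all_boot all_algebra finmap.
From mathcomp Require Import boolp classical_sets functions cardinality fsbigop.

Set Implicit Arguments.
Unset Strict Implicit.
Unset Printing Implicit Defensive.

Import Defs GRing.Theory.

Local Open Scope classical_set_scope.
Local Open Scope ring_scope.

(** * Linear maps, spans and quotients by spans *)

Section LinearMaps.
Variable R : pzRingType.
Implicit Types A B C E M N T V W : lmodType R.

Definition mk_linear V W (f : V -> W) (lf : linear f) : {linear V -> W} :=
  HB.pack f (GRing.isLinear.Build R V W *:%R f lf).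

Definition pair_linear V M N (f : {linear V -> M}) (g : {linear V -> N}) :
  {linear V -> (M * N)%type}.
Proof.
by apply: (@mk_linear _ (M * N)%type (fun v => (f v, g v))) => a u v; rewrite !linearP.
Defined.

Definition copair_linear M N V (f : {linear M -> V}) (g : {linear N -> V}) :
  {linear (M * N)%type -> V}.
Proof.
apply: (@mk_linear (M * N)%type _ (fun p => f p.1 + g p.2)) => a u v.
by rewrite !linearP /= scalerDr addrACA.
Defined.

Definition inl_linear M N : {linear M -> (M * N)%type}.
Proof.
apply: (@mk_linear M (M * N)%type (fun m => (m, 0))) => a u v.
by congr (_, _); rewrite /= scaler0 addr0.
Defined.

Definition inr_linear M N : {linear N -> (M * N)%type}.
Proof.
apply: (@mk_linear N (M * N)%type (fun m => (0, m))) => a u v.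
by congr (_, _); rewrite /= scaler0 addr0.
Defined.

Lemma span_sub V (S : set V) : S `<=` span S.
Proof.
move=> v Sv; exists 1%N, (fun=> 1), (fun=> v); split=> //.
by rewrite big_ord1 scale1r.
Qed.

Lemma span_submod V (S : set V) a u v : span S u -> span S v -> span S (a *: u + v).
Proof.
by move=> /asboolP Su /asboolP Sv; apply/asboolP; have [_] := spanb_closed S; apply.
Qed.

Lemma span_min V (S : set V) (P : V -> Prop) : P 0 ->
  (forall a u v, P u -> P v -> P (a *: u + v)) -> S `<=` P -> span S `<=` P.
Proof.
move=> P0 PD SP v [n [c [u [Su ->]]]].
(* Closure under [a *: u + v] gives sums by taking [a = 1] and multiples by taking [v = 0]. *)
by elim/big_ind: _ => // [? ? ? ?|i _];
  [rewrite -[X in X + _]scale1r|rewrite -[X in P X]addr0]; apply: PD => //; apply: SP.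
Qed.

Lemma span1E V (w v : V) : span [set w] v <-> exists r, v = r *: w.
Proof.
split=> [|[r ->]]; last first.
  rewrite -[_ *: _]addr0; apply: span_submod; first exact: span_sub.
  by apply/asboolP; have [] := spanb_closed [set w].
move: v; apply: span_min => [|a _ _ [r ->] [s ->]|_ ->].
- by exists 0; rewrite scale0r.
- by exists (a * r + s); rewrite scalerDl scalerA.
- by exists 1; rewrite scale1r.
Qed.

Fact quot_pi_linear V (S : set V) : linear (quot_pi S).
Proof. by move=> a u v; rewrite quot_piD quot_piZ. Qed.

Definition quot_proj V (S : set V) : {linear V -> quot_span S} :=
  mk_linear (@quot_pi_linear V S).

Lemma quot_pi0 V (S : set V) : quot_pi S 0 = 0.
Proof. exact: (linear0 (quot_proj S)). Qed.

Lemma quot_pi_eq0 V (S : set V) v : quot_pi S v = 0 <-> span S v.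
Proof. by rewrite -(quot_pi0 S) quot_piP subr0. Qed.

Lemma quot_lift V W (S : set V) (f : {linear V -> W}) :
  (forall v, S v -> f v = 0) ->
  exists g : {linear quot_span S -> W}, forall v, g (quot_pi S v) = f v.
Proof.
move=> fS.
have f0 v : span S v -> f v = 0.
  move: v; apply: span_min => // [|a u v fu fv]; first exact: linear0.
  by rewrite linearP fu fv scaler0 addr0.
pose g (q : quot_span S) : W := f (repr q).
have gE v : g (quot_pi S v) = f v.
  apply/eqP; rewrite -subr_eq0 -linearB; apply/eqP/f0/quot_piP.
  by rewrite /quot_pi reprK.
have lg : linear g.
  move=> a p q; have [u <-] := quot_pi_surj p; have [v <-] := quot_pi_surj q.
  by rewrite -quot_pi_linear !gE linearP.
by exists (mk_linear lg).
Qed.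

Lemma choose_lift A B (g : {linear A -> B}) : range g = setT ->
  exists s : B -> A, cancel s g.
Proof.
move=> gT; suff /choice[s sK] : forall b, exists a, g a = b by exists s.
by move=> b; have [a _ ga] : range g b by [rewrite gT]; exists a.
Qed.

End LinearMaps.

(** * Direct sums: induction principle and universal property *)

Section DirectSums.
Variables (R : pzRingType) (T : lmodType R) (X : Type).
Implicit Types (V W : lmodType R) (f g : dsum T X).

(** [X] is a bare type; [{classic X}] gives it the choice structure that [fset_set] and finitely
    supported sums require. *)
Lemma dsum_finite f : finite_set [set y : {classic X} | f y <> 0].
Proof. by case: f => f /= /asboolP. Qed.

Lemma dsum_ext f g : (forall y, f y = g y) -> f = g.
Proof. by move=> fg; apply/val_inj/funext. Qed.

Lemma dsum_in_linear (y : X) : linear (@dsum_in R T X y).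
Proof.
move=> a u v; apply: dsum_ext => z /=.
rewrite -[RHS]/(a *: dsum_in y u z + dsum_in y v z) /=.
by case: asboolP; rewrite ?scaler0 ?addr0.
Qed.

Definition dsum_inl (y : X) : {linear T -> dsum T X} := mk_linear (dsum_in_linear y).

(** An element is the finite sum of its components over its support. *)
Lemma dsum_ind (P : dsum T X -> Prop) :
  P 0 -> (forall f g, P f -> P g -> P (f + g)) ->
  (forall y t, P (dsum_in y t)) -> forall f, P f.
Proof.
move=> P0 PD Pin f.
suff -> : f = \sum_(y <- fset_set [set y : {classic X} | f y <> 0])
                dsum_in (y : X) (f y).
  by elim/big_ind: _.
apply: dsum_ext => z.
have -> (s : seq {classic X}) (F : {classic X} -> dsum T X) :
    (\sum_(y <- s) F y : dsum T X) z = \sum_(y <- s) F y z.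
  by elim: s => [|y s IH]; rewrite ?big_nil// !big_cons -IH.
have [fz|fz] := pselect (f z = 0).
  rewrite fz big1_seq//= => y; rewrite in_fset_set; last exact: dsum_finite.
  by rewrite inE /=; case: asboolP => // <-.
rewrite (bigD1_seq (z : {classic X})) ?fset_uniq//=; last first.
  by rewrite in_fset_set ?inE//; exact: dsum_finite.
rewrite asboolT// big1 ?addr0// => y yz; case: asboolP => // zy.
by move: yz; rewrite zy eqxx.
Qed.

Section Lift.
Variables (V : lmodType R) (u : X -> {linear T -> V}).

Definition dsum_sum (f : dsum T X) : V := \sum_(y \in [set: {classic X}]) u y (f y).

(** Allows several elements to be summed over one common index set, as linearity of [dsum_sum]
    requires. *)
Lemma dsum_sumE (A : set {classic X}) f : [set y : {classic X} | f y <> 0] `<=` A ->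
  dsum_sum f = \sum_(y \in A) u y (f y).
Proof.
move=> fA; apply/esym/fsbig_widen => // y [_ nAy] /=.
by rewrite (_ : f y = 0) ?linear0//; apply: contrapT => /fA.
Qed.

Fact dsum_sum_linear : linear dsum_sum.
Proof.
move=> a f g.
pose A : set {classic X} := [set y | f y <> 0] `|` [set y | g y <> 0].
have finA : finite_set A by rewrite finite_setU; split; exact: dsum_finite.
rewrite !(@dsum_sumE A); first last.
- move=> y /= H; apply: contrapT => /not_orP [/contrapT Hf /contrapT Hg].
  by apply: H; rewrite -[LHS]/(a *: f y + g y) Hf Hg scaler0 addr0.
- by move=> y; left.
- by move=> y; right.
rewrite !fsbig_finite// scaler_sumr -big_split; apply: eq_bigr => y _.
exact: (linearP (u y) a (f y) (g y)).
Qed.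

Definition dsum_lift : {linear dsum T X -> V} := mk_linear dsum_sum_linear.

Lemma dsum_lift_in (y : X) (t : T) : dsum_lift (dsum_in y t) = u y t.
Proof.
rewrite /= (@dsum_sumE [set (y : {classic X})]); last by move=> z /=; case: asboolP.
by rewrite fsbig_set1 /= asboolT.
Qed.

(** Meant for [h] a coordinate projection: it reads off a coordinate of a linear combination to
    which only the term at [y0] contributes. *)
Lemma dsum_lift_single W (h : {linear V -> W}) (y0 : X) f :
  (forall y, y <> y0 -> h (u y (f y)) = 0) ->
  h (dsum_lift f) = h (u y0 (f y0)).
Proof.
move=> hu; rewrite /= (@dsum_sumE [set y : {classic X} | f y <> 0])//.
rewrite fsbig_finite; last exact: dsum_finite.
rewrite linear_sum -fsbig_finite; last exact: dsum_finite.
(* Since [y0] may lie outside the support of [f], the sum is widened to all indices before it is cut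
   down to [y0]. *)
rewrite (@fsbig_widen _ _ _ _ _ setT)//; last first.
  by move=> y [_ /contrapT fy]; rewrite /= fy !linear0.
rewrite -(@fsbig_widen _ _ _ _ [set (y0 : {classic X})]) ?fsbig_set1//.
by move=> y [_ yy0]; apply: hu.
Qed.

End Lift.

Fact dsum_proj_linear (y : X) : linear (fun f : dsum T X => f y).
Proof. by []. Qed.

Definition dsum_proj (y : X) : {linear dsum T X -> T} := mk_linear (dsum_proj_linear y).

End DirectSums.

(** * Projective modules, short exact sequences and extensions *)

Section Homological.
Variable R : pzRingType.
Implicit Types A B C E M N P Q T V W : lmodType R.

Fact scale_linear_subproof V (v : V) : linear (fun r : R^o => (r : R) *: v).
Proof. by move=> a r s; rewrite scalerDl scalerA. Qed.

Definition scale_linear V (v : V) : {linear R^o -> V} :=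
  mk_linear (scale_linear_subproof v).

Definition prod_linear A B V W (f : {linear A -> V}) (g : {linear B -> W}) :
    {linear (A * B)%type -> (V * W)%type} :=
  pair_linear (f \o fst) (g \o snd).

Lemma dsum_in_regular X (y : X) (t : R) :
  dsum_in y (t : R^o) = t *: dsum_in y (1 : R^o).
Proof.
apply: dsum_ext => z /=; rewrite -[RHS]/(t * (if `[< z = y >] then 1 else 0)).
by case: asboolP; rewrite ?mulr1 ?mulr0.
Qed.

Lemma dsum_projective X : projective (dsum (R^o : lmodType R) X).
Proof.
move=> A B g f /choose_lift[s sK].
exists (dsum_lift (fun y => scale_linear (s (f (dsum_in y (1 : R^o)))))).
apply: dsum_ind => [|u v IHu IHv|y t]; first by rewrite !linear0.
  by rewrite !linearD IHu IHv.
by rewrite dsum_lift_in [in RHS]dsum_in_regular !linearZ /= sK.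
Qed.

Lemma regular_projective : projective (R^o : lmodType R).
Proof.
move=> A B g f /choose_lift[s sK]; exists (scale_linear (s (f (1 : R^o)))) => r.
by rewrite linearZ /= sK -linearZ [_ *: _]mulr1.
Qed.

Lemma prod_projective P Q : projective P -> projective Q -> projective (P * Q)%type.
Proof.
move=> projP projQ A B g f gT.
have [h hE] := projP _ _ g (f \o inl_linear P Q) gT.
have [k kE] := projQ _ _ g (f \o inr_linear P Q) gT.
exists (copair_linear h k) => -[p q].
rewrite [LHS]linearD /= hE kE /= -linearD; congr (f _).
by congr (_, _); rewrite /= ?addr0 ?add0r.
Qed.

Lemma rangeTP V W (f : {linear V -> W}) :
  (forall w, exists v, f v = w) -> range f = setT.
Proof. by move=> H; apply/seteqP; split=> // w _; have [v] := H w; exists v. Qed.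

Lemma short_exactP A B C (f : {linear A -> B}) (g : {linear B -> C}) :
  (forall a, f a = 0 -> a = 0) -> (forall a, g (f a) = 0) ->
  (forall b, g b = 0 -> exists a, f a = b) -> (forall c, exists b, g b = c) ->
  short_exact f g.
Proof.
move=> fI gf gK gT; split; last exact: rangeTP.
- move=> u v fuv; apply/eqP; rewrite -subr_eq0; apply/eqP/fI.
  by rewrite linearB fuv subrr.
- apply/seteqP; split=> [_ [a _ <-]|b /gK[a fa]]; first exact: gf.
  by exists a.
Qed.

Lemma short_exactE A B C (f : {linear A -> B}) (g : {linear B -> C}) :
  short_exact f g ->
  [/\ forall a, f a = 0 -> a = 0, forall a, g (f a) = 0,
      forall b, g b = 0 -> exists a, f a = b & forall c, exists b, g b = c].
Proof.
move=> [fI fg gT]; split=> [a fa|a|b gb|c].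
- by apply: fI; rewrite fa linear0.
- by have : range f (f a) by [exists a]; rewrite fg.
- have : (g @^-1` [set 0]) b by [].
  by rewrite -fg => -[a _ fa]; exists a.
- by have [b _ gb] : range g c by [rewrite gT]; exists b.
Qed.

Lemma short_exact_prod A B C (A' B' C' : lmodType R)
    (f : {linear A -> B}) (g : {linear B -> C})
    (f' : {linear A' -> B'}) (g' : {linear B' -> C'}) :
  short_exact f g -> short_exact f' g' ->
  short_exact (prod_linear f f') (prod_linear g g').
Proof.
move=> /short_exactE[fI gf gK gT] /short_exactE[fI' gf' gK' gT'].
apply: short_exactP => [[a a'] /= []|[a a']|[b b'] /= []|[c c']].
- by move=> /fI -> /fI' ->.
- by congr (_, _); [apply: gf|apply: gf'].
- by move=> /gK[a <-] /gK'[a' <-]; exists (a, a').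
- by have [b <-] := gT c; have [b' <-] := gT' c'; exists (b, b').
Qed.

Lemma pd_le1_prod A B : pd_le1 A -> pd_le1 B -> pd_le1 (A * B)%type.
Proof.
move=> [P1 [P0 [i [p [projP1 projP0 ip]]]]] [Q1 [Q0 [j [q [projQ1 projQ0 jq]]]]].
exists (P1 * Q1)%type, (P0 * Q0)%type, (prod_linear i j), (prod_linear p q).
by split; [apply: prod_projective..|apply: short_exact_prod].
Qed.

(** For the Fuchs-Salce module this is the sequence 0 -> R -> T0 -> T1 -> 0 of the tilting
    condition. *)
Lemma short_exact_scale V (w : V) : (forall r : R, r *: w = 0 -> r = 0) ->
  short_exact (scale_linear w) (quot_proj [set w]).
Proof.
move=> wI; apply: short_exactP => [r|r|v|q]; first exact: wI.
- by apply/quot_pi_eq0/span1E; exists r.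
- by move=> /quot_pi_eq0/span1E[r ->]; exists r.
- exact: quot_pi_surj.
Qed.

Lemma isomorphic_dsum_unit T : isomorphic T (dsum T unit).
Proof.
exists (dsum_inl T tt); exists (fun f : dsum T unit => f tt) => [t|f] /=.
  by rewrite asboolT.
by apply: dsum_ext => -[] /=; rewrite asboolT.
Qed.

Lemma Add_prodl A B : Add (A * B)%type A.
Proof. by exists unit, B; apply: isomorphic_dsum_unit. Qed.

Lemma Add_prodr A B : Add (A * B)%type B.
Proof.
exists unit, A; have [f bf] := isomorphic_dsum_unit (A * B)%type.
exists (f \o pair_linear snd fst); apply: bij_comp => //=.
by exists (fun p => (p.2, p.1)) => -[].
Qed.

(** The element [e - s (p e)] lies in the kernel of [p], hence comes from a unique [r e] in [M]; the
    pair [(r, p)] is the equivalence. *)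
Lemma section_ext_equiv T M (E : extension T M) (s : {linear T -> ext_mid E}) :
  (forall t, ext_proj E (s t) = t) -> ext_equiv E (split_extension T M).
Proof.
case: E s => E i p ip s /= ps; have [iI pi pK _] := short_exactE ip.
have : forall e, exists m, i m = e - s (p e).
  by move=> e; apply: pK; rewrite linearB ps subrr.
move=> /choice[r rE].
have iI' : injective i by case: (ip).
have lr : linear r.
  move=> a u v; apply: iI'; rewrite (linearP i) !rE (linearP p) (linearP s) scalerBr.
  by rewrite opprD addrACA.
exists (pair_linear (mk_linear lr) p); split=> //= m.
by congr (_, _); [apply: iI'; rewrite rE pi linear0 subr0|apply: pi].
Qed.

Lemma ext_equiv_retraction T M (E : extension T M) :
  ext_equiv E (split_extension T M) ->
  exists r : {linear ext_mid E -> M}, forall m, r (ext_inj E m) = m.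
Proof. by move=> [h [hi _]]; exists (fst \o h) => m /=; rewrite hi. Qed.

(* The pushout of [0 -> R -> V -> V/Rw -> 0] along [r |-> r *: n]. *)
Lemma pushout_extension V N (w : V) (n : N) : (forall r : R, r *: w = 0 -> r = 0) ->
  exists (E : extension (quot_span [set w]) N) (j : {linear V -> ext_mid E}),
    j w = ext_inj E n.
Proof.
move=> wI; pose S : set (V * N)%type := [set (w, - n)].
have /quot_lift[p pE] : forall v, S v -> (quot_proj [set w] \o fst) v = 0.
  by move=> _ -> /=; apply/quot_pi_eq0/span_sub.
pose i : {linear N -> quot_span S} := quot_proj S \o inr_linear V N.
pose j : {linear V -> quot_span S} := quot_proj S \o inl_linear V N.
have ip : short_exact i p.
  apply: short_exactP => [m|m|e|q].
  (* If (0, m) = r (w, -n), then r w = 0, so r = 0 by the hypothesis on [w], and m = 0. *)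
  - move=> /quot_pi_eq0/span1E[r [/esym/wI -> ->]].
    by rewrite scale0r.
  - by rewrite /i /= pE; apply: quot_pi0.
  - have [[v m] <-] := quot_pi_surj e; rewrite pE => /quot_pi_eq0/span1E[r /= ->].
    (* Modulo (w, -n), the pair (r w, m) equals (0, m + r n). *)
    exists (m + r *: n); apply/quot_piP/span1E; exists (- r).
    by congr (_, _); rewrite /= ?sub0r ?scaleNr// scalerN opprK addrC addKr.
  - by have [v <-] := quot_pi_surj q; exists (j v); rewrite /j /= pE.
exists (Extension ip), j; apply/quot_piP/span1E; exists 1.
by rewrite scale1r; congr (_, _); rewrite /= ?subr0 ?sub0r.
Qed.

(** The pushout [E] extends V/Rw by N; adding [V] as a direct summand to its middle term and its
    quotient makes it an extension of V + V/Rw, which splits by assumption. The retraction onto [N],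
    composed with [V -> E], sends [w] to [n]. *)
Lemma perp_hom V N (w : V) : (forall r : R, r *: w = 0 -> r = 0) ->
  perp (V * quot_span [set w])%type N ->
  forall n : N, exists h : {linear V -> N}, h w = n.
Proof.
move=> wI TN n; have [[E i p ip] [j /= jw]] := pushout_extension n wI.
have [iI pi pK pT] := short_exactE ip.
pose i' : {linear N -> (V * E)%type} := inr_linear V E \o i.
pose p' : {linear (V * E)%type -> (V * quot_span [set w])%type} := prod_linear idfun p.
have ip' : short_exact i' p'.
  apply: short_exactP => [m [/iI]//|m|[v e] /= [-> /pK[m <-]]|[v q]].
  - by congr (_, _); apply: pi.
  - by exists m.
  - by have [e <-] := pT q; exists (v, e).
have [r rE] := ext_equiv_retraction (TN (Extension ip')).
by exists (r \o inr_linear V E \o j); rewrite /= jw; apply: rE.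
Qed.

End Homological.

(** * Divisibility in terms of the chosen generators *)

Section FuchsSalceModule.
Variables (R : comPzRingType) (II : set (set R)).
Variables (n : II -> nat) (x : forall I : II, 'I_(n I) -> R).
Arguments x : clear implicits.
Hypothesis gen_II : forall I : II, generates (x I) (\val I).
Implicit Types A B M N V W : lmodType R.

Local Notation idx := (FS_index n).
Local Notation child l I k := (rcons l (existT (fun J : II => 'I_(n J)) I k) : idx).
Local Notation b l := (FS_basis l : FS_free n).
Local Notation MI := (FS_module x).
Local Notation w := (FS_w x).
Local Notation m_ l := (quot_pi (FS_relators x) (b l) : MI).

(** Membership of [m] in IN, normalized to one coefficient in [N] per chosen generator of I; [DivP]
    gives the link with [Div]. *)
Definition combination_of N (I : II) (m : N) : Prop :=
  exists t : 'I_(n I) -> N, m = \sum_k x I k *: t k.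

Definition divisible N : Prop :=
  forall (I : II) (m : N), combination_of I m.

Lemma combination_of0 N (I : II) : combination_of I (0 : N).
Proof. by exists (fun=> 0); rewrite big1// => k _; rewrite scaler0. Qed.

Lemma combination_of_submod N (I : II) a (u v : N) :
  combination_of I u -> combination_of I v -> combination_of I (a *: u + v).
Proof.
move=> [s ->] [t ->]; exists (fun k => a *: s k + t k).
rewrite scaler_sumr -big_split; apply: eq_bigr => k _.
by rewrite /= scalerDr !scalerA mulrC.
Qed.

Lemma combination_of_linear N N' (f : {linear N -> N'}) (I : II) (m : N) :
  combination_of I m -> combination_of I (f m).
Proof.
move=> [t ->]; exists (f \o t).
by rewrite linear_sum; apply: eq_bigr => k _; rewrite linearZ.
Qed.

Lemma DivP N : Div II N <-> divisible N.
Proof.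
have xI (I : II) k : val I (x I k).
  by rewrite -gen_II; apply: (span_sub (V := R^o)); exists k.
split=> [divN I m|divN I II_I].
  have : @ideal_smul R (val I) N m by rewrite -divN//; apply: set_valP.
  (* Two nested span inductions: over the products a m that span IM, then over [a] in the span of
     the generators of I. *)
  move: m; apply: span_min; first exact: combination_of0.
    by move=> a u v; apply: combination_of_submod.
  move=> _ [a Ia [m _ <-]]; move: a Ia; rewrite -gen_II.
  apply: (span_min (V := R^o)) => [|a u v Cu Cv|_ [k _ <-]].
  - by rewrite scale0r; apply: combination_of0.
  - by rewrite scalerDl -scalerA; apply: combination_of_submod.
  - exists (fun j => if j == k then m else 0).
    by rewrite (bigD1 k)//= eqxx big1 ?addr0// => j /negPf ->; rewrite scaler0.
apply/seteqP; split=> // m _.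
pose J : II := exist _ I (mem_set II_I); have [t ->] := divN J m.
exists (n J), (fun=> 1), (fun k => x J k *: t k); split=> [k|].
  by exists (x J k); [apply: (xI J)|exists (t k)].
by apply: eq_bigr => k _; rewrite scale1r.
Qed.

Lemma divisible_onto N N' (f : {linear N -> N'}) : range f = setT ->
  divisible N -> divisible N'.
Proof.
move=> fT divN I m; have [m' _ <-] : range f m by rewrite fT.
exact/combination_of_linear/divN.
Qed.

Lemma divisible_dsum N X : divisible N -> divisible (dsum N X).
Proof.
move=> divN I f.
(* The coefficients are required to be 0 wherever [f] is, so that each of them is again finitely
   supported in [y]. *)
have /choice[t tE] y : exists t : 'I_(n I) -> N,
    f y = \sum_k x I k *: t k /\ (f y = 0 -> t = fun=> 0).
  have [fy|fy] := pselect (f y = 0); last first.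
    by have [t tE] := divN I (f y); exists t; split.
  by exists (fun=> 0); rewrite fy big1// => k _; rewrite scaler0.
have supp_t k : finsupp (fun y => t y k).
  apply/asboolP; apply: sub_finite_set (dsum_finite f) => y /= ty fy.
  by apply: ty; rewrite (tE y).2.
exists (fun k => DSum (supp_t k)); apply: dsum_ext => y; rewrite (tE y).1.
elim/big_rec2: _ => //= k u v _ ->.
by [].
Qed.

Lemma divisible_prod N N' : divisible N -> divisible N' -> divisible (N * N')%type.
Proof.
move=> divN divN' I [m m'].
have -> : (m, m') = 1 *: inl_linear N N' m + inr_linear N N' m'.
  by rewrite scale1r; congr (_, _); rewrite /= ?addr0 ?add0r.
by apply: combination_of_submod; apply: combination_of_linear.
Qed.

(** * Divisibility of the Fuchs-Salce module and lifting of maps out of it *)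

Lemma FS_relation (l : idx) (I : II) : m_ l = \sum_k x I k *: m_ (child l I k).
Proof.
have -> : \sum_k x I k *: m_ (child l I k) =
    quot_pi (FS_relators x) (\sum_k x I k *: b (child l I k)).
  rewrite -[RHS]/(quot_proj (FS_relators x) _) linear_sum.
  by apply: eq_bigr => k _; rewrite linearZ.
by apply/quot_piP/span_sub; exists l, I.
Qed.

Lemma FS_module_divisible : divisible MI.
Proof.
move=> I q; have [v <-] := quot_pi_surj q.
elim/dsum_ind: v => [|u v IHu IHv|l r].
- by rewrite quot_pi0; apply: combination_of0.
- rewrite quot_piD -[quot_pi _ u]scale1r; exact: combination_of_submod.
rewrite dsum_in_regular quot_piZ -[quot_scale _ _]addr0.
apply: combination_of_submod; last exact: combination_of0.
by exists (fun k => m_ (child l I k)); apply: FS_relation.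
Qed.

Lemma FS_delta_divisible : divisible (FS_delta x).
Proof.
apply: divisible_prod; first exact: FS_module_divisible.
apply: (divisible_onto (f := quot_proj [set w])); last exact: FS_module_divisible.
by apply: rangeTP; apply: quot_pi_surj.
Qed.

(* Lifts of the basis elements are corrected along the tree of finite
   sequences: the lift at [l] being fixed, divisibility of the kernel allows to
   choose the lifts at its children so that the relators at [l] hold. *)
Lemma FS_module_lift A B (g : {linear A -> B}) (f : {linear MI -> B}) (a0 : A) :
  range g = setT ->
  (forall (I : II) a, g a = 0 -> exists t : 'I_(n I) -> A,
     (forall k, g (t k) = 0) /\ a = \sum_k x I k *: t k) ->
  g a0 = f w ->
  exists h : {linear MI -> A}, (forall m, g (h m) = f m) /\ h w = a0.
Proof.
move=> /choose_lift[s sK] divK ga0.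
(* The condition that [p.2] lifts the value at [p.1] is a premise inside the existential, so
   [choice] yields a total function [st] and the recursion below carries no proofs. *)
have step (p : idx * A) : exists t : forall I, 'I_(n I) -> A, g p.2 = f (m_ p.1) ->
    forall I, p.2 = \sum_k x I k *: t I k /\
              forall k, g (t I k) = f (m_ (child p.1 I k)).
  case: p => l a /=; have [ga|ga] := pselect (g a = f (m_ l)); last first.
    by exists (fun _ _ => 0) => /ga.
  have stepI (I : II) : exists t : 'I_(n I) -> A, a = \sum_k x I k *: t k /\
      forall k, g (t k) = f (m_ (child l I k)).
    (* By the relation at [l], arbitrary lifts at the children miss [a] by an element of the kernel
       of [g]; its coefficients [t], also in the kernel, correct these lifts. *)
    have [|t [gt tE]] := divK I (a - \sum_k x I k *: s (f (m_ (child l I k)))).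
      rewrite linearB linear_sum ga (FS_relation l I) linear_sum.
      apply/eqP; rewrite subr_eq0; apply/eqP/eq_bigr => k _.
      by rewrite !linearZ /= sK.
    exists (fun k => t k + s (f (m_ (child l I k)))); split=> [|k]; last first.
      by rewrite linearD gt sK add0r.
    under eq_bigr do rewrite scalerDr.
    by rewrite big_split /= -tE subrK.
  by exists (fun I => sval (cid (stepI I))) => _ I; case: cid.
have [st stE] := choice step.
(* Children are appended at the end, so the recursion runs on reversed sequences, where the last
   pair is the head. *)
pose fix r (l : idx) : A :=
  if l is existT J k :: l' then st (rev l', r l') J k else a0.
have rE (l : idx) : g (r l) = f (m_ (rev l)).
  elim: l => [//|[I k] l IH]; rewrite rev_cons /=.
  by have [_] := stE (rev l, r l) IH I.
have [F FE] : exists F : {linear FS_free n -> A}, forall l, F (b l) = r (rev l).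
  exists (dsum_lift (fun l : idx => scale_linear (r (rev l)))) => l.
  by rewrite dsum_lift_in /= scale1r.
have F0 v : FS_relators x v -> F v = 0.
  move=> [l [I ->]]; rewrite linearB linear_sum FE.
  apply/eqP. rewrite subr_eq0; apply/eqP.
  have := stE (rev (rev l), r (rev l)) (rE _) I; rewrite /= revK => -[-> _].
  by apply: eq_bigr => k _; rewrite linearZ FE rev_rcons /= revK.
have [h hE] := quot_lift F0; exists h; split; last by rewrite hE FE.
move=> m; have [v <-] := quot_pi_surj m; rewrite hE.
elim/dsum_ind: v => [|u v IHu IHv|l t].
- by rewrite quot_pi0 !linear0.
- by rewrite quot_piD !linearD IHu IHv.
by rewrite dsum_in_regular quot_piZ !linearZ FE /= rE revK.
Qed.

(** A lifting problem over the zero module [dsum N void]: the kernel is all of [N], and only the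
    value at [w] is prescribed. *)
Lemma divisible_hom N :
  divisible N -> forall m : N, exists h : {linear MI -> N}, h w = m.
Proof.
move=> divN m.
have [|I a _||h [_ hw]] := @FS_module_lift N (dsum N void) \0 \0 m; last by exists h.
- by apply: rangeTP => f; exists 0; apply: dsum_ext => -[].
- by have [t ->] := divN I a; exists t.
- by [].
Qed.

(** The kernel of [p] is an image of [N], hence divisible, so both summands lift to [E] and give a
    section. On the second summand [w] is lifted to 0, which makes the lift factor through M/Rw. *)
Lemma divisible_perp N : divisible N -> perp (FS_delta x) N.
Proof.
move=> divN [E i p ip]; have [iI pi pK pT] := short_exactE ip.
have pT' : range p = setT by case: (ip).
have divK (I : II) a : p a = 0 -> exists t : 'I_(n I) -> E,
    (forall k, p (t k) = 0) /\ a = \sum_k x I k *: t k.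
  move=> /pK[m <-]; have [t ->] := divN I m; exists (i \o t).
  split=> [k|]; first exact: pi.
  by rewrite linear_sum; apply: eq_bigr => k _; rewrite linearZ.
pose f1 := inl_linear MI (quot_span [set w]).
pose f2 := inr_linear MI (quot_span [set w]) \o quot_proj [set w].
have [e pe] := pT (f1 w).
have [h1 [ph1 _]] := FS_module_lift pT' divK pe.
have [|h2 [ph2 h2w]] := FS_module_lift (f := f2) (a0 := 0) pT' divK.
  rewrite linear0 /f2 /=; congr (_, _); apply/esym/quot_pi_eq0.
  exact: span_sub.
have [|s sE] := quot_lift (S := [set w]) (f := h2); first by move=> _ ->.
apply: (section_ext_equiv (E := Extension ip) (s := copair_linear h1 s)) => -[m q] /=.
have [v <-] := quot_pi_surj q; rewrite sE linearD ph1 ph2.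
by congr (_, _); rewrite /= ?addr0 ?add0r.
Qed.

(** One copy of the module is taken for each element [m] of [N]; its first summand maps to [N] with
    [w] going to [m]. *)
Lemma hom_Gen N : (forall m : N, exists h : {linear MI -> N}, h w = m) ->
  Gen (FS_delta x) N.
Proof.
move=> /choice[h hw]; exists N, (dsum_lift (fun m => h m \o fst)).
by apply: rangeTP => m; exists (dsum_in m (w, 0)); rewrite dsum_lift_in /= hw.
Qed.

Lemma Gen_divisible N : Gen (FS_delta x) N -> divisible N.
Proof.
move=> [X [f fT]]; apply: divisible_onto fT _.
exact/divisible_dsum/FS_delta_divisible.
Qed.

(** * Linear independence of the relators and w; projective dimension *)

Hypothesis faithful_II : forall I, II I -> faithful I.

Definition relator (p : idx * II) : FS_free n :=
  b p.1 - \sum_k x p.2 k *: b (child p.1 p.2 k).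

Definition relator_map : {linear dsum R^o (idx * II) -> FS_free n} :=
  dsum_lift (fun p => scale_linear (relator p)).

Definition relator_w_map : {linear (dsum R^o (idx * II) * R^o)%type -> FS_free n} :=
  copair_linear relator_map (scale_linear (b [::])).

Lemma relator_w_mapE c r : relator_w_map (c, r) = relator_map c + r *: b [::].
Proof. by []. Qed.

Lemma range_relator_map v : span (FS_relators x) v <-> exists c, relator_map c = v.
Proof.
split=> [|[c <-]].
  move: v; apply: span_min => [|a u v [c <-] [d <-]|_ [l [I ->]]].
  - by exists 0; rewrite linear0.
  - by exists (a *: c + d); rewrite linearP.
  - by exists (dsum_in (l, I) (1 : R^o)); rewrite dsum_lift_in /= scale1r.
have span0 : span (FS_relators x) 0 by apply/quot_pi_eq0/quot_pi0.
elim/dsum_ind: c => [|c d IHc IHd|[l I] r]; first by rewrite linear0.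
  by rewrite linearD -[relator_map c]scale1r; apply: span_submod.
rewrite /relator_map dsum_lift_in -[X in span _ X]addr0; apply: span_submod => //.
by apply: span_sub; exists l, I.
Qed.

(** A nonempty sequence determines its parent and its last pair, so it occurs as a child in the
    relator of [(l, I)] only, and there just once. *)
Lemma relator_child (p : idx * II) (l : idx) (I : II) (k : 'I_(n I)) :
  relator p (child l I k) =
    (if `[< child l I k = p.1 >] then 1 else 0)
    - (if `[< p = (l, I) >] then x I k else 0).
Proof.
pose ev : {linear FS_free n -> R^o} := dsum_proj R^o (child l I k).
rewrite -[LHS]/(ev _) /relator linearB linear_sum; congr (_ - _).
under eq_bigr do rewrite linearZ /=.
case: asboolP => [->/=|pl].
  rewrite (bigD1 k)//= asboolT// [_ *: _]mulr1 big1 ?addr0// => j jk.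
  case: asboolP => [|_]; last exact: mulr0.
  move=> /rcons_inj[] /esym/eqP; rewrite eq_Tagged /= => /eqP jk'.
  by rewrite jk' eqxx in jk.
rewrite big1// => j _; case: asboolP => [|_]; last exact: mulr0.
case: p pl j => l' J /= pl j /rcons_inj[ll' IJ _].
by case: pl; rewrite ll' IJ.
Qed.

(* At the coordinate [child l I k] the relator [(l, I)] contributes [- x I k],
   and the only other ones contributing are indexed by longer sequences. So
   vanishing coefficients propagate from long sequences to shorter ones: each
   coefficient of [l] annihilates [I]. *)
Lemma relator_w_map_inj (q : (dsum R^o (idx * II) * R^o)%type) :
  relator_w_map q = 0 -> q = 0.
Proof.
case: q => c r; rewrite relator_w_mapE => cr0.
(* The support of [c] is finite, so its sequences have length below some [m]; the induction then
   lowers this bound to 0. *)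
have [m cm] : exists m, forall p : idx * II, (m <= size p.1)%N -> c p = 0.
  pose s : seq {classic (idx * II)} :=
    fset_set [set p : {classic (idx * II)} | c p <> 0].
  exists (\max_(p <- s) size p.1).+1 => p; apply: contraPP => cp.
  have ps : (p : {classic (idx * II)}) \in s.
    by rewrite in_fset_set ?inE//; exact: dsum_finite.
  apply/negP; rewrite -leqNgt.
  pose sz (p : {classic (idx * II)}) := size p.1.
  exact: (@leq_bigmax_seq _ s xpredT sz _ ps).
have c0 p0 : c p0 = 0.
  elim: m cm => [|m IHm] cm; first exact: cm.
  apply: IHm => -[l I] /= ml.
  suff : Ann (val I) (c (l, I)) by rewrite faithful_II; [|apply: set_valP].
  move=> a; rewrite -gen_II; move: a.
  apply: (span_min (V := R^o)) => [|a u v cu cv|_ [k _ <-]].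
  - exact: mulr0.
  - by rewrite mulrDr cv addr0 mulrCA cu mulr0.
  pose ev : {linear FS_free n -> R^o} := dsum_proj R^o (child l I k).
  have /(congr1 ev) := cr0; rewrite linear0 linearD.
  (* A child is never the empty sequence, so the term at [w] does not contribute. *)
  have -> : ev (r *: b [::]) = 0.
    rewrite linearZ /= asboolF; first exact: mulr0.
    by case: (l).
  rewrite addr0 (dsum_lift_single (y0 := (l, I))) => [|p pl].
    rewrite -[ev _]/(c (l, I) * relator (l, I) (child l I k)) relator_child.
    rewrite asboolF ?asboolT//; last first.
      by move=> /(congr1 size)/eqP; rewrite size_rcons eqn_leq ltnn.
    by rewrite sub0r mulrN => /eqP; rewrite oppr_eq0 => /eqP.
  rewrite -[LHS]/(c p * relator p (child l I k)) relator_child (asboolF pl) subr0.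
  case: asboolP => [lp|_]; last exact: mulr0.
  by rewrite cm ?mul0r// -lp size_rcons ltnS.
have cE : c = 0 by apply: dsum_ext.
(* Once [c = 0], the coordinate at the empty sequence is [r] itself. *)
congr (_, _) => //; move: cr0; rewrite cE linear0 add0r.
pose ev : {linear FS_free n -> R^o} := dsum_proj R^o ([::] : idx).
move=> /(congr1 ev); rewrite linear0 linearZ /= asboolT//.
by rewrite [_ *: _]mulr1.
Qed.

(** If r w = 0 in F/G, then [r *: b [::]] is some [relator_map c], and [(c, - r)] lies in the kernel
    of [relator_w_map]. *)
Lemma FS_w_free (r : R) : r *: w = 0 -> r = 0.
Proof.
rewrite -[_ *: w]quot_piZ => /quot_pi_eq0/range_relator_map[c cE].
suff [_ /eqP] : (c, - r : R^o) = 0 by rewrite oppr_eq0 => /eqP.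
by apply: relator_w_map_inj; rewrite relator_w_mapE cE scaleNr subrr.
Qed.

Lemma pd_le1_FS_module : pd_le1 MI.
Proof.
exists (dsum R^o (idx * II)), (FS_free n), relator_map, (quot_proj (FS_relators x)).
split; [exact: dsum_projective..|apply: short_exactP => [c c0|c|v|q]].
- suff [] : (c, 0 : R^o) = 0 by [].
  by apply: relator_w_map_inj; rewrite relator_w_mapE c0 scale0r addr0.
- by apply/quot_pi_eq0/range_relator_map; exists c.
- by move=> /quot_pi_eq0/range_relator_map.
- exact: quot_pi_surj.
Qed.

Lemma pd_le1_FS_quotient : pd_le1 (quot_span [set w]).
Proof.
exists (dsum R^o (idx * II) * R^o)%type, (FS_free n), relator_w_map.
(* The kernel of the composite F -> M -> M/Rw is G + Rw, the image of [relator_w_map]. *)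
exists (quot_proj [set w] \o quot_proj (FS_relators x)); split.
- by apply: prod_projective; [apply: dsum_projective|apply: regular_projective].
- exact: dsum_projective.
have wE r : r *: w = quot_pi (FS_relators x) (r *: b [::]) by rewrite quot_piZ.
apply: short_exactP => [|[c r]|v|q]; first exact: relator_w_map_inj.
- apply/quot_pi_eq0/span1E; exists r; rewrite wE; apply/quot_piP/range_relator_map.
  by exists c; rewrite relator_w_mapE addrK.
- move=> /quot_pi_eq0/span1E[r]; rewrite wE => /quot_piP/range_relator_map[c cE].
  by exists (c, r); rewrite relator_w_mapE cE subrK.
- have [u <-] := quot_pi_surj q; have [v <-] := quot_pi_surj u.
  by exists v.
Qed.

(** * Equality of the three classes and the tilting property *)

Lemma FS_delta_perp N : perp (FS_delta x) N <-> Gen (FS_delta x) N.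
Proof.
split=> [/(perp_hom FS_w_free)/hom_Gen//|/Gen_divisible]; exact: divisible_perp.
Qed.

Lemma FS_delta_Gen N : Gen (FS_delta x) N <-> Div II N.
Proof.
by rewrite DivP; split=> [|/divisible_hom/hom_Gen//]; apply: Gen_divisible.
Qed.

Lemma FS_delta_tilting : tilting1 (FS_delta x).
Proof.
split=> [|X|].
- by apply: pd_le1_prod; [apply: pd_le1_FS_module|apply: pd_le1_FS_quotient].
- exact/divisible_perp/divisible_dsum/FS_delta_divisible.
(* T0 and T1 are the two summands of the Fuchs-Salce tilting module, and R -> T0 sends 1 to [w]. *)
exists MI, (quot_span [set w]), (scale_linear w), (quot_proj [set w]).
split; [exact/short_exact_scale/FS_w_free|exact: Add_prodl|exact: Add_prodr].
Qed.

End FuchsSalceModule.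

Theorem proposition4p3 (R : comPzRingType) (II : set (set R))
    (n : II -> nat) (x : forall I : II, 'I_(n I) -> R)
    (ideal_II : forall I, II I -> is_ideal I)
    (faithful_II : forall I, II I -> faithful I)
    (gen_II : forall I : II, generates (x I) (\val I)) :
  [/\ tilting1 (FS_delta x),
      forall M : lmodType R, perp (FS_delta x) M <-> Gen (FS_delta x) M
    & forall M : lmodType R, Gen (FS_delta x) M <-> Div II M].
Proof.
split; [exact: FS_delta_tilting|exact: FS_delta_perp|exact: FS_delta_Gen].
Qed.
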